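(* Let $M$ be a one-tape NTM with $q$ states and let $C,D\in\mathbb N$. Put $\ell=D+8q^C$, $r=D+12q^C$ and $\mathcal S=\bigcup_{n=1}^{\ell}\mathcal S_n(M)$. Then $M$ runs in time $Cn+D$ if and only if both of the following hold: (a) for every input $w$ with $|w|\le\ell$ and every computation $\zeta$ of $M$ on $w$, $|\zeta|\le C|w|+D$; (b) for every $\mathcal C\in\mathcal S$ and every part $w\in\Sigma^+$ with $|w|\le r$ and $t_M(w,\mathcal C)\ge 0$, we have $t_M(w,\mathcal C)\le C|w|$.
   Context: A one-tape NTM is $M=(Q,\Sigma,\Gamma,\sqcup,\delta,q_0,q_{acc},q_{rej})$ with $\delta:(Q\setminus\{q_{acc},q_{rej}\})\times\Gamma\to\mathcal P(Q\times\Gamma\times\{-1,1\})\setminus\{\emptyset\}$ (head moves every step), start, accept, reject states pairwise distinct. $|\zeta|$ is the number of steps of computation $\zeta$; $M$ runs in time $T(n)$ if every computation on every input of length $n$ has at most $T(n)$ steps. Tape cells are numbered by integers, $M$ starts on cell $0$, and input $w$ has its $i$-th symbol in cell $i-1$, other cells blank; boundary $i$ is the boundary between cells $i-1$ and $i$. If in the first $t$ steps of computation $\zeta$ on $w$ the head crosses boundary $i$ at steps $t_1<t_2<\dots$ and $M$ is in state $q_j$ after step $t_j$, the crossing sequence is $\mathcal C_i^t(M,\zeta,w)=(q_1,q_2,\dots)$. Define $\mathcal S_n(M)=\{\mathcal C_i^t(M,\zeta,w): |w|=n,\ 1\le i\le n,\ \zeta$ a computation on $w$, $t\le|\zeta|\}$.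 Computation on a part: let $w$ with $|w|=n\ge1$ and $\mathcal C=(q_1,\dots,q_l)$ finite. Configurations are tuples $(\mathcal C_1,\tilde w,i,\tilde q,\mathcal C_2)$ with $\tilde w\in\Gamma^n$, $0\le i\le n-1$, $\tilde q\in Q$, $\mathcal C_1,\mathcal C_2$ sequences of states. The start configuration is $((q_2,\dots,q_l),w,0,q_1,(q_1,\dots,q_l))$. $(\mathcal C_{1A},w_A,i,q_A,\mathcal C_{2A})$ can be followed by $(\mathcal C_{1B},w_B,j,q_B,\mathcal C_{2B})$ if either (1) $(w_A,i,q_A)\to(w_B,j,q_B)$ is an ordinary move of $M$ staying within cells $0..n-1$ and $\mathcal C_{1A}=\mathcal C_{1B}$, $\mathcal C_{2A}=\mathcal C_{2B}$; or (2) $i=j=0$, $\mathcal C_{1A}=(\tilde q,q_B,\mathcal C_{1B})$, $w_A=a\hat w$, $w_B=b\hat w$, $(\tilde q,b,-1)\in\delta(q_A,a)$, $\mathcal C_{2A}=\mathcal C_{2B}$; or (3) $i=j=n-1$, $\mathcal C_{2A}=(\tilde q,q_B,\mathcal C_{2B})$, $w_A=\hat wa$, $w_B=\hat wb$, $(\tilde q,b,1)\in\delta(q_A,a)$, $\mathcal C_{1A}=\mathcal C_{1B}$. A special ending configuration follows $((q_l),a\hat w,0,\tilde q,())$ if $(q_l,b,-1)\in\delta(\tilde q,a)$ for some $b$, or $((),\hat wa,n-1,\tilde q,(q_l))$ if $(q_l,b,1)\in\delta(\tilde q,a)$ for some $b$. A valid computation $\zeta$ of $M$ on part $w$ with ending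 crossing sequence $\mathcal C$ is a sequence of successive configurations from the start configuration to an ending configuration; its length is $|\zeta|=\sum_{i=1}^{n-1}|\mathcal C_i(M,\zeta,w,\mathcal C)|+|\mathcal C|$, where $\mathcal C_i(M,\zeta,w,\mathcal C)$ is the crossing sequence produced on internal boundary $i$. $t_M(w,\mathcal C)\in\mathbb N\cup\{-1\}$ is the maximum length of such valid computations, and $-1$ if none exists or $|\mathcal C|=\infty$. *)

(* Defs.v *)
From HB Require Import structures.
From mathcomp Require Import all_boot all_order all_algebra.
From mathcomp Require Import boolp classical_sets constructive_ereal.
Set Implicit Arguments.
Unset Strict Implicit.
Unset Printing Implicit Defensive.

Local Open Scope nat_scope.
Local Open Scope classical_set_scope.

(* N together with infinity: None is infinity. *)
Definition le_oo (x y : option nat) : bool :=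
  match x, y with
  | _, None => true
  | Some m, Some n => m <= n
  | None, Some _ => false
  end.

(* Finite or infinite sequences. *)
Inductive xseq (T : Type) : Type :=
| Fin of seq T
| Inf of (nat -> T).

(* In an element (p, b, d) of delta, d : bool is the direction of the head
   move: true is +1 (right), false is -1 (left).  The partial transition
   function is encoded by giving it the value set0 exactly at the halting
   states. *)
Record ntm := Ntm {
  state : finType;
  symbol : finType;
  alphabet : {set symbol};
  blank : symbol;
  delta : state -> symbol -> {set state * symbol * bool};
  q_start : state;
  q_acc : state;
  q_rej : state;
  blank_notin_alphabet : blank \notin alphabet;
  states_uniq : uniq [:: q_start; q_acc; q_rej];
  delta_eq0 : forall p a,
    (delta p a == finset.set0) = (p \in [:: q_acc; q_rej])
}.

Section Machine.
Variable M : ntm.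

Definition is_input (w : seq (symbol M)) : bool :=
  all (fun a => a \in alphabet M) w.

Definition halting (p : state M) : bool := p \in [:: q_acc M; q_rej M].

Record config := Config {
  cstate : state M;
  ctape : int -> symbol M;
  chead : int
}.

Definition shift (d : bool) : int := if d then 1%R else (-1)%R.

Definition step (x y : config) : Prop :=
  exists (p : state M) (b : symbol M) (d : bool),
    (p, b, d) \in delta (cstate x) (ctape x (chead x)) /\
    y = Config p (fun j => if j == chead x then b else ctape x j)
          (chead x + shift d)%R.

Definition start (w : seq (symbol M)) : config :=
  Config (q_start M)
    (fun j => if j is Posz i then nth (blank M) w i else blank M) 0%R.

(* A sequence of configurations conf 0, conf 1, ..., with nsteps steps; the
   values of conf beyond nsteps are irrelevant. *)
Record run := Run { conf : nat -> config; nsteps : option nat }.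

Definition computation (w : seq (symbol M)) (z : run) : Prop :=
  [/\ conf z 0 = start w,
      forall k, le_oo (Some k.+1) (nsteps z) -> step (conf z k) (conf z k.+1)
    & forall n, nsteps z = Some n -> halting (cstate (conf z n))].

Definition runs_in_time (T : nat -> nat) : Prop :=
  forall w, is_input w -> forall z, computation w z ->
    le_oo (nsteps z) (Some (T (size w))).

(* Step k leads from conf z k.-1 to conf z k. *)
Definition crosses (z : run) (i : int) (k : nat) : bool :=
  (0 < k) &&
  ((chead (conf z k.-1) == (i - 1)%R) && (chead (conf z k) == i)
   || (chead (conf z k.-1) == i) && (chead (conf z k) == (i - 1)%R)).

(* c is the sequence of states in which z crosses boundary i during its
   first t steps; ts lists the times of these crossings. *)
Definition is_crossing_seq (z : run) (i : int) (t : option nat)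
    (c : xseq (state M)) : Prop :=
  match c with
  | Fin s => exists ts : seq nat,
      [/\ sorted ltn ts,
          forall k, k \in ts = crosses z i k && le_oo (Some k) t
        & s = [seq cstate (conf z k) | k <- ts]]
  | Inf f => exists ts : nat -> nat,
      [/\ {homo ts : j k / j < k},
          forall k, (exists j, ts j = k) <->
                    crosses z i k && le_oo (Some k) t
        & forall j, f j = cstate (conf z (ts j))]
  end.

Definition crossing_seqs (n : nat) : set (xseq (state M)) :=
  [set c | exists (w : seq (symbol M)) (z : run) (i : nat) (t : option nat),
    [/\ is_input w /\ size w = n, 1 <= i <= n, computation w z,
        le_oo t (nsteps z) & is_crossing_seq z (Posz i) t c]].

(* Configurations of a computation on a part: PEnd is the special ending
   configuration. *)
Inductive pconfig : Type :=
| PConf of seq (state M) & seq (symbol M) & nat & state M & seq (state M)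
| PEnd.

Inductive pstep : pconfig -> pconfig -> Prop :=
| PMoveR c1 w i p c2 p' b :
    i.+1 < size w -> (p', b, true) \in delta p (nth (blank M) w i) ->
    pstep (PConf c1 w i p c2)
          (PConf c1 (set_nth (blank M) w i b) i.+1 p' c2)
| PMoveL c1 w i p c2 p' b :
    i.+1 < size w -> (p', b, false) \in delta p (nth (blank M) w i.+1) ->
    pstep (PConf c1 w i.+1 p c2)
          (PConf c1 (set_nth (blank M) w i.+1 b) i p' c2)
| PLeft c1 w p c2 r p' a b :
    (r, b, false) \in delta p a ->
    pstep (PConf (r :: p' :: c1) (a :: w) 0 p c2)
          (PConf c1 (b :: w) 0 p' c2)
| PRight c1 w p c2 r p' a b :
    (r, b, true) \in delta p a ->
    pstep (PConf c1 (rcons w a) (size w) p (r :: p' :: c2))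
          (PConf c1 (rcons w b) (size w) p' c2)
| PEndLeft w p r a b :
    (r, b, false) \in delta p a ->
    pstep (PConf [:: r] (a :: w) 0 p [::]) PEnd
| PEndRight w p r a b :
    (r, b, true) \in delta p a ->
    pstep (PConf [::] (rcons w a) (size w) p [:: r]) PEnd.

(* There is no start configuration, hence no valid computation, when the
   crossing sequence is empty. *)
Definition part_computation (w : seq (symbol M)) (s : seq (state M))
    (z : seq pconfig) : Prop :=
  if s is q1 :: s' then
    exists z' : seq pconfig,
      [/\ z = PConf s' w 0 q1 s :: z',
          path (fun x y => `[< pstep x y >]) (PConf s' w 0 q1 s) z'
        & last (PConf s' w 0 q1 s) z' = PEnd]
  else False.

Definition pcross (i : nat) (x y : pconfig) : seq (state M) :=
  match x, y with
  | PConf _ _ j _ _, PConf _ _ k p _ =>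
      if (j.+1 == i) && (k == i) || (j == i) && (k.+1 == i)
      then [:: p] else [::]
  | _, _ => [::]
  end.

(* Initialising pairmap with PEnd only contributes an empty sequence. *)
Definition part_crossing_seq (z : seq pconfig) (i : nat) : seq (state M) :=
  flatten (pairmap (pcross i) PEnd z).

Definition part_length (w : seq (symbol M)) (s : seq (state M))
    (z : seq pconfig) : nat :=
  \sum_(1 <= i < size w) size (part_crossing_seq z i) + size s.

Definition part_lengths (w : seq (symbol M)) (c : xseq (state M)) : set nat :=
  match c with
  | Fin s => [set part_length w s z | z in part_computation w s]
  | Inf _ => set0
  end.

(* The maximum of part_lengths w c, and -1 if there is no valid computation.
   A nondeterministic machine can have arbitrarily long valid computations on
   one part; the value is then +oo. *)
Definition t_max (w : seq (symbol M)) (c : xseq (state M)) : \bar int :=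
  if `[< part_lengths w c = set0 >] then (- (1%:Z))%R%:E%E
  else xget +oo%E
    [set (Posz m)%:E%E | m in
       [set m | part_lengths w c m /\
                forall k, part_lengths w c k -> k <= m]].

End Machine.

Arguments crossing_seqs M n : clear implicits.

(* Main.v *)
Require Import Defs.
From HB Require Import structures.
From mathcomp Require Import all_boot all_order all_algebra.
From mathcomp Require Import boolp classical_sets constructive_ereal.
From mathcomp Require Import zify.
Set Implicit Arguments.
Unset Strict Implicit.
Unset Printing Implicit Defensive.
Import Order.TTheory GRing.Theory Num.Theory.
Local Open Scope nat_scope.
Local Open Scope classical_set_scope.

(* A family of crossing sequences, one per boundary, comes from a computation
   exactly when it is compatible cell by cell, and the number of steps is then
   the total length of the family.  Hence a segment of the input can be replaced
   by any part with the same crossing sequences at its two ends.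

   If a part with t_M(w, C) > C |w| existed, inserting it many times at the
   boundary where C occurs would break the time bound.  Conversely, take a
   shortest input w with a computation of more than C |w| + D steps and look at
   its first C |w| + D + 1 steps.  There are few short sequences, so counting
   gives two equal crossing sequences at distance at most r.  Cutting the part
   between them leaves an input that obeys the bound, so this part has length
   more than C times its size.  Its crossing sequence belongs to S, because
   further cuts on both sides of one boundary shorten the input to length l. *)

(** * Counting pairwise distinct sequences over a finite alphabet *)

Section Pigeonhole.
Variable T : finType.
Implicit Type ss : seq (seq T).

Lemma count_size_eq ss n :
  uniq ss -> count (fun s => size s == n) ss <= #|T| ^ n.
Proof.
move=> ss_uniq; rewrite -size_filter -card_tuple cardE.
rewrite -(size_map val (enum _)); apply: uniq_leq_size.
  exact: filter_uniq.
move=> s; rewrite mem_filter => /andP[sz_s _].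
by apply/mapP; exists (Tuple sz_s); rewrite ?mem_enum.
Qed.

Hypothesis T_ge3 : 3 <= #|T|.

(** A geometric sum: with $q\ge 3$ letters, $\sum_{k\le n} q^k \le (3q^n-1)/2$. *)
Lemma count_size_le ss n :
  uniq ss -> 2 * count (fun s => size s <= n) ss + 1 <= 3 * #|T| ^ n.
Proof.
move=> ss_uniq; elim: n => [|n IHn].
  have := count_size_eq 0 ss_uniq; rewrite expn0.
  by rewrite (eq_count (a2 := fun s => size s <= 0)) => [|s]; lia.
have -> : count (fun s => size s <= n.+1) ss =
    count (fun s => size s <= n) ss + count (fun s => size s == n.+1) ss.
  by elim: ss {ss_uniq IHn} => //= s ss ->; case: ltngtP; lia.
have := count_size_eq n.+1 ss_uniq.
by have := leq_mul T_ge3 (leqnn (#|T| ^ n)); rewrite expnS; lia.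
Qed.

(** Subtraction is truncated, so [s] contributes one for each [m] with [size s <= m <= n]. Summing
    the counts of [count_size_le] over [m] is again a geometric sum; the factor 3/2 enters twice and
    gives 9/4. *)
Lemma sum_size_deficit ss n :
  uniq ss -> 4 * (\sum_(s <- ss) (n.+1 - size s)) <= 9 * #|T| ^ n.
Proof.
move=> ss_uniq.
have recE m : \sum_(s <- ss) (m.+1 - size s) =
    \sum_(s <- ss) (m - size s) + count (fun s => size s <= m) ss.
  rewrite -sum1_count [in X in _ + X]big_mkcond -big_split /=.
  by apply: eq_bigr => s _; case: leqP; lia.
have cnt m := count_size_le m ss_uniq.
elim: n => [|n IHn]; rewrite recE.
  by rewrite big1 => [|s _]; [have := cnt 0; rewrite expn0; lia | lia].
have := cnt n.+1; have := leq_mul T_ge3 (leqnn (#|T| ^ n)).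
by rewrite expnS; lia.
Qed.

(** If the values on the window are distinct, each length is at least [n.+1] minus its deficit, and
    all deficits together are at most $\frac94 q^n$. *)
Lemma pigeonhole (f : nat -> seq T) n a m :
  (exists i j, [/\ a <= i, i < j, j < a + m & f i = f j]) \/
  4 * (n.+1 * m) <= 4 * (\sum_(a <= k < a + m) size (f k)) + 9 * #|T| ^ n.
Proof.
have [f_uniq|f_nuniq] := boolP (uniq (map f (index_iota a (a + m)))).
  right; have := sum_size_deficit n f_uniq; rewrite big_map.
  have -> : n.+1 * m = \sum_(a <= k < a + m) n.+1.
    by rewrite sum_nat_const_nat; lia.
  suff: \sum_(a <= k < a + m) n.+1 <= \sum_(a <= k < a + m) size (f k) +
      \sum_(a <= k < a + m) (n.+1 - size (f k)) by lia.
  by rewrite -big_split; apply: leq_sum => k _ /=; lia.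
left; have [i [j [lt_ij]]] := uniqPn (f a) f_nuniq.
rewrite size_map size_iota => lt_j.
rewrite !(nth_map 0) ?size_iota; [|lia..].
by rewrite !nth_iota; [|lia..]; exists (a + i), (a + j); split=> //; lia.
Qed.

Lemma pigeonhole_close (f : nat -> seq T) n m D r :
  D + 12 * #|T| ^ n <= r -> D + 8 * #|T| ^ n < m ->
  \sum_(1 <= k < m.+1) size (f k) <= n * m + D + 1 ->
  exists i j, [/\ 1 <= i, i < j, j <= m, j - i <= r & f i = f j].
Proof.
move=> r_ge m_gt sum_le; set N := #|T| ^ n in r_ge m_gt *.
have [//|no_pair] :=
  pselect (exists i j, [/\ 1 <= i, i < j, j <= m, j - i <= r & f i = f j]).
have N_gt0 : 0 < N by rewrite expn_gt0; lia.
(* Indices in a window of length at most [r.+1] differ by at most [r], so the values there are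
   distinct. *)
have window a k : 0 < a -> k <= r.+1 -> a + k <= m.+1 ->
    4 * (n.+1 * k) <= 4 * (\sum_(a <= i < a + k) size (f i)) + 9 * N.
  move=> a_gt0 k_le ak_le; case: (pigeonhole f n a k) => // -[i] [j] [*].
  by case: no_pair; exists i, j; split=> //; lia.
(* Split into windows of length [r.+1]. Each full window has a surplus of [r.+1] over the rate [n],
   which pays for its own error $\frac94 N$; only the error of the last window remains. *)
have weak k a : 0 < a -> a + k <= m.+1 ->
    4 * (n * k) <= 4 * (\sum_(a <= i < a + k) size (f i)) + 9 * N.
  elim/ltn_ind: k a => k IHk a a_gt0 ak_le.
  have [k_le|k_gt] := leqP k r.+1.
    by have := window a k a_gt0 k_le ak_le; rewrite mulSn; lia.
  rewrite (big_cat_nat (n := a + r.+1)) ?leq_addr //=; last by lia.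
  have -> : n * k = n * r.+1 + n * (k - r.+1).
    by rewrite -mulnDr subnKC // ltnW.
  have := IHk (k - r.+1) ltac:(lia) (a + r.+1) ltac:(lia) ltac:(lia).
  have := window a r.+1 a_gt0 (leqnn _) ltac:(lia); rewrite mulSn.
  have -> : a + r.+1 + (k - r.+1) = a + k by lia.
  by lia.
(* A single window gives $m\le D+1+\frac94N$, against [m_gt]. Otherwise the surplus of the first
   window is kept and [weak] is used for the rest: $r\le D+\frac92N$, against [r_ge]. *)
have [m_le|m_gt'] := leqP m r.+1.
  have := window 1 m isT m_le ltac:(lia); rewrite add1n mulSn.
  by lia.
have := window 1 r.+1 isT (leqnn _) ltac:(lia); rewrite mulSn.
have := weak (m - r.+1) r.+2 isT ltac:(lia).
have -> : r.+2 + (m - r.+1) = m.+1 by lia.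
move: sum_le; rewrite (big_cat_nat (n := r.+2)) //=; last by lia.
have -> : n * m = n * r.+1 + n * (m - r.+1).
  by rewrite -mulnDr subnKC // ltnW.
by rewrite add1n; lia.
Qed.

End Pigeonhole.

(** * Crossing families and their compatibility at single cells *)

Section Histories.
Variable M : ntm.
Implicit Types (p : state M) (a b : symbol M) (d : bool) (h e : int).
Implicit Types (w : seq (symbol M)) (z : run M).
Implicit Types (C : int -> seq (state M)) (tape : int -> symbol M).

(* Where the head is, seen from one cell. *)
Inductive position := Here of state M | OnLeft | OnRight.

(* [cell_ok x a L R]: a cell that contains [a] while the head is at [x] can
   be crossed, from then on, with the sequences [L] and [R] on its left and
   right boundaries.  The head may finally stop anywhere. *)
Inductive cell_ok :
  position -> symbol M -> seq (state M) -> seq (state M) -> Prop :=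
| CellStop x a : cell_ok x a [::] [::]
| CellEnterL p a L R : cell_ok (Here p) a L R -> cell_ok OnLeft a (p :: L) R
| CellEnterR p a L R : cell_ok (Here p) a L R -> cell_ok OnRight a L (p :: R)
| CellExitL p a p' b L R :
    (p', b, false) \in delta p a -> cell_ok OnLeft b L R ->
    cell_ok (Here p) a (p' :: L) R
| CellExitR p a p' b L R :
    (p', b, true) \in delta p a -> cell_ok OnRight b L R ->
    cell_ok (Here p) a L (p' :: R).

Lemma cell_left_nil a R : cell_ok OnLeft a [::] R -> R = [::].
Proof. by move=> ok; inversion ok. Qed.

Lemma cell_right_nil a L : cell_ok OnRight a L [::] -> L = [::].
Proof. by move=> ok; inversion ok. Qed.

Lemma cell_left_cons p a L R :
  cell_ok OnLeft a (p :: L) R -> cell_ok (Here p) a L R.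
Proof. by move=> ok; inversion ok. Qed.

Lemma cell_right_cons p a L R :
  cell_ok OnRight a L (p :: R) -> cell_ok (Here p) a L R.
Proof. by move=> ok; inversion ok. Qed.

Definition locate h p k : position :=
  if k == h then Here p else if (h < k)%R then OnLeft else OnRight.

Lemma locate_here h p : locate h p h = Here p.
Proof. by rewrite /locate eqxx. Qed.

Lemma locate_left h p k : (h < k)%R -> locate h p k = OnLeft.
Proof. by rewrite /locate; case: eqP => [|_ ->] //; lia. Qed.

Lemma locate_right h p k : (k < h)%R -> locate h p k = OnRight.
Proof. by rewrite /locate => ?; rewrite !ifN //; lia. Qed.

(* The boundary crossed by a move from cell [h] in direction [d]. *)
Definition exit h d : int := if d then (h + 1)%R else h.

(** Sequences list the crossings still to come, so [push] goes back one step in time and [pop] goes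
    forward one step. *)
Definition push e p C k := if k == e then p :: C k else C k.
Definition pop e C k := if k == e then behead (C k) else C k.
Definition write h b tape k := if k == h then b else tape k.

(** A cell other than [h] notices the move only if the head arrives there. No transition of [M] is
    involved, so this also covers fictitious moves made outside a part. *)
Lemma cell_unmove_other h p p' a d C k :
  k != h ->
  cell_ok (locate (h + shift d)%R p' k) a (C k) (C (k + 1)%R) ->
  cell_ok (locate h p k) a (push (exit h d) p' C k)
    (push (exit h d) p' C (k + 1)%R).
Proof.
rewrite /push /exit; case: d => /=; case: (ltgtP k h) => // kh _.
- rewrite !locate_right; [|lia..]; rewrite !ifN //; lia.
- have [->|kh1] := eqVneq k (h + 1)%R.
    rewrite locate_here locate_left; last lia.
    by rewrite ?eqxx ifN; [exact: CellEnterL|lia].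
  rewrite !locate_left; [|lia..]; rewrite !ifN //; lia.
- have [->|kh1] := eqVneq k (h - 1)%R.
    rewrite locate_here locate_right; last lia.
    by rewrite subrK eqxx; exact: CellEnterR.
  rewrite !locate_right; [|lia..]; rewrite !ifN //; lia.
- rewrite !locate_left; [|lia..]; rewrite !ifN //; lia.
Qed.

Lemma cell_unmove h p p' b d tape C k :
  (p', b, d) \in delta p (tape h) ->
  cell_ok (locate (h + shift d)%R p' k) (write h b tape k) (C k)
    (C (k + 1)%R) ->
  cell_ok (locate h p k) (tape k) (push (exit h d) p' C k)
    (push (exit h d) p' C (k + 1)%R).
Proof.
rewrite /write; have [->|kh] := eqVneq k h; last first.
  by move=> _; apply: cell_unmove_other.
rewrite locate_here /push /exit; case: d => /= del.
  rewrite locate_right ?eqxx; last lia.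
  by rewrite ifN; [exact: CellExitR|lia].
rewrite locate_left ?eqxx; last lia.
by rewrite ifN; [exact: CellExitL|lia].
Qed.

Lemma cell_move_other h p p' a d C k S :
  k != h -> C (exit h d) = p' :: S ->
  cell_ok (locate h p k) a (C k) (C (k + 1)%R) ->
  cell_ok (locate (h + shift d)%R p' k) a (pop (exit h d) C k)
    (pop (exit h d) C (k + 1)%R).
Proof.
rewrite /pop /exit; case: d => /=; case: (ltgtP k h) => // kh _ CS.
- rewrite !locate_right; [|lia..]; rewrite !ifN //; lia.
- have [->|kh1] := eqVneq k (h + 1)%R.
    rewrite locate_here locate_left; last lia.
    by rewrite CS ifN; [exact: cell_left_cons|lia].
  rewrite !locate_left; [|lia..]; rewrite !ifN //; lia.
- have [->|kh1] := eqVneq k (h - 1)%R.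
    rewrite locate_here locate_right; last lia.
    by rewrite subrK eqxx CS; exact: cell_right_cons.
  rewrite !locate_right; [|lia..]; rewrite !ifN //; lia.
- rewrite !locate_left; [|lia..]; rewrite !ifN //; lia.
Qed.

(* When the head cell has nothing left to do, emptiness spreads outwards. *)
Lemma cells_nil (I : int -> Prop) h p tape C :
  (forall i j k, I i -> I k -> (i <= j)%R -> (j <= k)%R -> I j) -> I h ->
  (forall k, I k ->
    cell_ok (locate h p k) (tape k) (C k) (C (k + 1)%R)) ->
  C h = [::] -> C (h + 1)%R = [::] ->
  forall k, I k -> C k = [::] /\ C (k + 1)%R = [::].
Proof.
move=> convex Ih ok Ch Ch1.
have right n : I (h + Posz n)%R -> C (h + Posz n + 1)%R = [::].
  elim: n => [|n IHn]; first by rewrite addr0.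
  move=> In1; have In : I (h + Posz n)%R by apply: convex Ih In1 _ _; lia.
  have := ok _ In1; rewrite locate_left; last lia.
  have -> : (h + Posz n.+1)%R = (h + Posz n + 1)%R by lia.
  by rewrite IHn // => /cell_left_nil.
have left n : I (h - Posz n)%R -> C (h - Posz n)%R = [::].
  elim: n => [|n IHn]; first by rewrite subr0.
  move=> In1; have In : I (h - Posz n)%R by apply: convex In1 Ih _ _; lia.
  have := ok _ In1; rewrite locate_right; last lia.
  have -> : (h - Posz n.+1 + 1)%R = (h - Posz n)%R by lia.
  by rewrite IHn // => /cell_right_nil.
move=> k Ik; case: (ltgtP k h) => kh; last by rewrite kh.
  have kE : k = (h - Posz `|h - k|%N)%R by lia.
  have k1E : (k + 1)%R = (h - Posz `|h - k|.-1%N)%R by lia.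
  split; first by rewrite kE; apply: left; rewrite -kE.
  by rewrite k1E; apply: left; apply: (convex k _ h) => //; lia.
have kE : k = (h + Posz `|k - h|%N)%R by lia.
have k1E : k = (h + Posz `|k - h|.-1%N + 1)%R by lia.
split; last by rewrite kE; apply: right; rewrite -kE.
by rewrite k1E; apply: right; apply: (convex h _ k) => //; lia.
Qed.

(** The rule that holds at the head cell decides: stopping empties all sequences by [cells_nil], and
    an exit supplies the transition. [I] will be all of the integers for runs, and the cells of a
    part for computations on it. *)
Lemma cells_move (I : int -> Prop) h p tape C :
  (forall i j k, I i -> I k -> (i <= j)%R -> (j <= k)%R -> I j) -> I h ->
  (forall k, I k ->
    cell_ok (locate h p k) (tape k) (C k) (C (k + 1)%R)) ->
  (forall k, I k -> C k = [::] /\ C (k + 1)%R = [::]) \/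
  exists p' b d S, [/\ (p', b, d) \in delta p (tape h),
    C (exit h d) = p' :: S &
    forall k, I k -> cell_ok (locate (h + shift d)%R p' k)
      (write h b tape k) (pop (exit h d) C k) (pop (exit h d) C (k + 1)%R)].
Proof.
move=> convex Ih ok.
have := ok h Ih; rewrite locate_here.
move Ex : (Here p) => x; move Ea : (tape h) => a.
move EL : (C h) => L; move ER : (C (h + 1)%R) => R okh.
case: okh Ex Ea EL ER => {x a L R} //.
- by move=> x a _ _ EL ER; left; apply: cells_nil ok EL ER.
- move=> p0 a p' b L R del okh [?] Ea EL ER; subst p0; right.
  exists p', b, false, L; split=> // k Ik.
  rewrite /write; case: eqVneq => [->|kh]; last first.
    exact: (cell_move_other kh EL (ok k Ik)).
  by rewrite locate_left /pop /= ?eqxx ?EL ?ifN ?ER //=; lia.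
- move=> p0 a p' b L R del okh [?] Ea EL ER; subst p0; right.
  exists p', b, true, R; split=> // k Ik.
  rewrite /write; case: eqVneq => [->|kh]; last first.
    exact: (cell_move_other kh ER (ok k Ik)).
  by rewrite locate_right /pop /= ?eqxx ?ER ?ifN ?EL //=; lia.
Qed.

(** * Runs of the machine and their histories *)

Definition total C t := exists2 ks : seq int, uniq ks &
  (forall k, k \notin ks -> C k = [::]) /\ \sum_(k <- ks) size (C k) = t.

Lemma total_push e p C t : total C t -> total (push e p C) t.+1.
Proof.
move=> [ks ks_uniq [supp <-]].
have [e_ks|e_ks] := boolP (e \in ks).
  exists ks => //; split=> [k k_ks|].
    by rewrite /push ifN ?supp //; apply: contraNneq k_ks => ->.
  rewrite !(bigD1_seq e) //= {1}/push eqxx addSn; congr (_ + _).+1.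
  by apply: eq_bigr => k k_e; rewrite /push ifN.
exists (e :: ks); first by rewrite /= e_ks.
split=> [k|].
  by rewrite inE negb_or => /andP[k_e k_ks]; rewrite /push ifN ?supp.
rewrite big_cons {1}/push eqxx supp //= add1n; congr _.+1.
rewrite !big_seq; apply: eq_bigr => k k_ks.
by rewrite /push ifN //; apply: contraNneq e_ks => <-.
Qed.

Lemma total_pop e p S C t :
  C e = p :: S -> total C t -> exists2 t', t = t'.+1 & total (pop e C) t'.
Proof.
move=> CS [ks ks_uniq [supp <-]].
have e_ks : e \in ks by apply: contraPT CS => /supp ->.
rewrite (bigD1_seq e) //= CS addSn; eexists; first by [].
exists ks => //; split=> [k k_ks|].
  by rewrite /pop ifN ?supp //; apply: contraNneq k_ks => ->.
rewrite (bigD1_seq e) //= {1}/pop eqxx CS; congr (_ + _).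
by apply: eq_bigr => k k_e; rewrite /pop ifN.
Qed.

(* States at the crossings of boundary [i] during steps [u+1, ..., u+n]. *)
Definition crossings (z : run M) (u n : nat) (i : int) : seq (state M) :=
  [seq cstate (conf z k) | k <- iota u.+1 n & crosses z i k].

Lemma crossings_push z u n d :
  chead (conf z u.+1) = (chead (conf z u) + shift d)%R ->
  crossings z u n.+1 =
    push (exit (chead (conf z u)) d) (cstate (conf z u.+1))
      (crossings z u.+1 n).
Proof.
move=> headE; apply/funext => i; rewrite /crossings /push /=.
have -> : crosses z i u.+1 = (i == exit (chead (conf z u)) d).
  by rewrite /crosses /exit /= headE; case: d {headE} => /=; lia.
by case: eqP.
Qed.

(** The run is undone from its last step to its first. Each step crosses exactly one boundary, which
    costs one [push], so the total length counts the steps. *)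
Lemma run_history z u n :
  (forall k, u <= k < u + n -> step (conf z k) (conf z k.+1)) ->
  (forall k, cell_ok (locate (chead (conf z u)) (cstate (conf z u)) k)
    (ctape (conf z u) k) (crossings z u n k) (crossings z u n (k + 1)%R)) /\
  total (crossings z u n) n.
Proof.
elim: n u => [|n IHn] u steps.
  by split=> [k|]; [exact: CellStop|exists [::]; rewrite ?big_nil].
have [|cells tot] := IHn u.+1; first by move=> k ?; apply: steps; lia.
have [p' [b [d [del confE]]]] := steps u ltac:(lia).
have headE : chead (conf z u.+1) = (chead (conf z u) + shift d)%R.
  by rewrite confE.
rewrite (crossings_push _ headE); split; last exact: total_push.
move=> k; apply: (cell_unmove (b := b)); first by rewrite confE.
have tapeE :
    ctape (conf z u.+1) k = write (chead (conf z u)) b (ctape (conf z u)) k.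
  by rewrite confE.
by have := cells k; rewrite headE tapeE.
Qed.

Lemma history_run t x C :
  (forall k, cell_ok (locate (chead x) (cstate x) k) (ctape x k) (C k)
    (C (k + 1)%R)) -> total C t ->
  exists z, [/\ conf z 0 = x,
    forall k, k < t -> step (conf z k) (conf z k.+1) & crossings z 0 t = C].
Proof.
elim: t x C => [|t IHt] x C cells tot.
  exists (Run (fun=> x) None); split=> //; apply/funext => i.
  rewrite /crossings /=; have [ks _ [supp /eqP]] := tot.
  have [i_ks|/supp ->//] := boolP (i \in ks).
  rewrite sum_nat_seq_eq0 => /allP/(_ i i_ks) /=.
  by rewrite size_eq0 => /eqP ->.
have [nilC|[p' [b [d [S [del CS moved]]]]]] := cells_move (I := fun=> True)
    (fun _ _ _ _ _ _ _ => I) I (fun k _ => cells k).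
  have [ks _ [_]] := tot.
  by rewrite big1 // => k _; have [|->] := nilC k.
have [t' [<-] tot'] := total_pop CS tot.
pose x' := Config p' (fun j => if j == chead x then b else ctape x j)
  (chead x + shift d)%R.
have [z [z0 steps crossE]] := IHt x' _ (fun k => moved k I) tot'.
pose z' := Run (fun k => if k is k'.+1 then conf z k' else x) None.
exists z'; split=> [//||].
  case=> [_|k k_t] /=; last exact: steps.
  by rewrite z0; exists p', b, d.
rewrite (@crossings_push _ _ _ d) /= ?z0 //.
have -> : crossings z' 1 t = crossings z 0 t.
  apply/funext => i; rewrite /crossings (iotaDl 1 1) filter_map -map_comp.
  congr map; apply: eq_in_filter => k; rewrite mem_iota => /andP[k_gt0 _].
  by rewrite /crosses /= ?add1n /=; case: k k_gt0.
rewrite crossE; apply/funext => i.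
by rewrite /push /pop; case: eqP => // ->; rewrite CS.
Qed.

(** A family describes only finitely many steps, while a computation must halt or be infinite. Since
    [delta] is nonempty at every state that is not halting, the run can be continued. *)
Lemma run_extend w z t :
  conf z 0 = start w -> (forall k, k < t -> step (conf z k) (conf z k.+1)) ->
  exists z', [/\ computation w z', le_oo (Some t) (nsteps z') &
    forall k, k <= t -> conf z' k = conf z k].
Proof.
move=> z0 steps.
have /choice[next nextP] : forall x : config M,
    exists y, ~~ halting (cstate x) -> step x y.
  move=> x; have [_|run_x] := boolP (halting (cstate x)); first by exists x.
  have : delta (cstate x) (ctape x (chead x)) != finset.set0.
    by rewrite delta_eq0.
  case/set0Pn => -[[p b] d] del.
  by eexists => _; exists p, b, d; split; first exact: del.
pose g k := iter k next (conf z t).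
pose f k := if k <= t then conf z k else g (k - t).
have fE k : f (t + k) = g k.
  rewrite /f addKn; case: k => [|k]; first by rewrite addn0 leqnn.
  by rewrite ifN //; lia.
have f_step k : (t <= k -> ~~ halting (cstate (f k))) -> step (f k) (f k.+1).
  have [k_t _|t_k /(_ isT)] := ltnP k t.
    by rewrite /f ltnW // k_t; apply: steps.
  by rewrite -(subnKC t_k) -addnS !fE => /nextP.
have f0 : f 0 = start w by [].
have f_le k : k <= t -> f k = conf z k by rewrite /f => ->.
(* The computation stops at the first halting configuration from time [t] on, and is infinite if
   there is none. *)
have [ex_halt|no_halt] := pselect (exists k, halting (cstate (g k))).
  have [m haltm min_m] := ex_minnP ex_halt.
  exists (Run f (Some (t + m))); split=> //=; last by rewrite leq_addr.
  split=> //= [k k_lt|_ [<-]]; last by rewrite fE.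
  apply: f_step => t_k; apply/negP; rewrite -(subnKC t_k) fE => /min_m; lia.
exists (Run f None); split=> //; split=> //= k _.
apply: f_step => t_k; apply/negP => halt_k; case: no_halt.
by exists (k - t); rewrite -fE subnKC.
Qed.

Definition history w C t :=
  (forall k, cell_ok (locate 0%R (q_start M) k) (ctape (start w) k) (C k)
    (C (k + 1)%R)) /\ total C t.

Lemma computation_history w z t :
  computation w z -> le_oo (Some t) (nsteps z) ->
  history w (crossings z 0 t) t.
Proof.
move=> [z0 steps _] t_le; have [|cells tot] := @run_history z 0 t.
  move=> k /andP[_ k_lt]; apply: steps.
  by move: t_le; case: (nsteps z) => //= m; apply: leq_trans.
by split=> // k; have := cells k; rewrite z0.
Qed.

Lemma history_computation w C t :
  history w C t -> exists z, [/\ computation w z,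
    le_oo (Some t) (nsteps z) & crossings z 0 t = C].
Proof.
move=> [cells tot].
have [z [z0 steps <-]] := @history_run t (start w) C cells tot.
have [z' [comp t_le agree]] := run_extend z0 steps.
exists z'; split=> //; apply/funext => i; rewrite /crossings.
have sub k : k \in iota 1 t -> k <= t by rewrite mem_iota add1n => /andP[].
have -> : [seq k <- iota 1 t | crosses z' i k] =
    [seq k <- iota 1 t | crosses z i k].
  by apply: eq_in_filter => k /sub k_t; rewrite /crosses !agree //; lia.
by apply/eq_in_map => k; rewrite mem_filter => /andP[_ /sub/agree ->].
Qed.

Lemma crossingsP z i t s :
  is_crossing_seq z i (Some t) (Fin s) <-> s = crossings z 0 t i.
Proof.
split=> [[ts [ts_sorted tsP ->]]|->].
  rewrite /crossings; congr map; apply: (irr_sorted_eq ltn_trans ltnn) => //.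
    apply: sorted_filter; [exact: ltn_trans|exact: iota_ltn_sorted].
  move=> k; rewrite tsP mem_filter mem_iota /= add1n ltnS.
  by case: k => [|k]; rewrite /crosses ?ltnS //= andbA.
exists [seq k <- iota 1 t | crosses z i k]; split=> //.
  apply: sorted_filter; [exact: ltn_trans|exact: iota_ltn_sorted].
move=> k; rewrite mem_filter mem_iota /= add1n ltnS.
by case: k => [|k]; rewrite /crosses.
Qed.

(** * Replacing a segment of the input *)

Lemma sum_support C (ks ks' : seq int) :
  uniq ks -> (forall k, k \notin ks -> C k = [::]) -> uniq ks' ->
  \sum_(k <- ks') size (C k) = \sum_(k <- ks | k \in ks') size (C k).
Proof.
move=> ks_uniq supp ks'_uniq; rewrite (bigID (mem ks)) /=.
rewrite [X in _ + X]big1 ?addn0 => [|k /supp -> //].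
rewrite -big_filter -[RHS]big_filter; apply/perm_big/uniq_perm.
- exact: filter_uniq.
- exact: filter_uniq.
- by move=> k; rewrite !mem_filter andbC.
Qed.

Lemma uniq_Posz_iota m n : uniq (map Posz (index_iota m n)).
Proof. by rewrite map_inj_uniq ?iota_uniq // => x y []. Qed.

Lemma sum_le_total C t m n :
  total C t -> \sum_(m <= k < n) size (C (Posz k)) <= t.
Proof.
move=> [ks ks_uniq [supp <-]].
have := sum_support ks_uniq supp (uniq_Posz_iota m n).
rewrite big_map => ->.
by rewrite [leqRHS](bigID (mem (map Posz (index_iota m n)))) leq_addr.
Qed.

(** The head starts to the left of every cell, so [B 0] includes the first entry into the part. *)
Definition part_ok w (B : nat -> seq (state M)) :=
  forall k, k < size w -> cell_ok OnLeft (nth (blank M) w k) (B k) (B k.+1).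

Lemma history_part w C t i m :
  history w C t -> 1 <= i -> i + m <= size w ->
  part_ok (take m (drop i w)) (fun k => C (Posz (i + k))).
Proof.
move=> [cells _] i_gt0 im_le k; rewrite size_take size_drop => k_lt.
have k_m : k < m by move: k_lt; case: ifP; lia.
rewrite nth_take // nth_drop addnS.
have := cells (Posz (i + k)); rewrite locate_left /=; last lia.
by have -> : (Posz (i + k) + 1)%R = Posz (i + k).+1 by lia.
Qed.

(** Compatibility concerns single cells, so families can be glued at boundaries where they agree. In
    the time balance boundary [i] is counted with the prefix and boundary [j] with the segment. *)
Lemma history_replace w C t i j v B :
  history w C t -> 1 <= i -> i <= j -> j <= size w ->
  part_ok v B -> B 0 = C i -> B (size v) = C j ->
  exists C' t', [/\ history (take i w ++ v ++ drop j w) C' t',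
    t' + \sum_(i.+1 <= k < j.+1) size (C (Posz k)) =
      t + \sum_(1 <= k < (size v).+1) size (B k),
    forall k : nat, k <= i -> C' k = C k &
    forall k : nat, j <= k -> C' (Posz (k - j + (i + size v))) = C k].
Proof.
move=> [cells [ks ks_uniq [supp tE]]] i_gt0 ij j_w v_ok B0 Bm.
set m := size v in Bm *.
pose C' k := if (k <= Posz i)%R then C k else
  if (k <= Posz (i + m))%R then B `|k - Posz i|%N
  else C (k - Posz (i + m) + Posz j)%R.
have C'1 k : (k <= Posz i)%R -> C' k = C k by rewrite /C' => ->.
have C'2 k : k <= m -> C' (Posz (i + k)) = B k.
  rewrite /C'; case: k => [_|k k_m]; first by rewrite addn0 lexx B0.
  rewrite ifN; last lia.
  by rewrite ifT; [congr B; lia|lia].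
have C'3 k : (Posz (i + m) <= k)%R ->
    C' k = C (k - Posz (i + m) + Posz j)%R.
  have [->|k_ne] := eqVneq k (Posz (i + m)).
    by rewrite C'2 // Bm subrr add0r.
  by move=> k_ge; rewrite /C' !ifN //; lia.
have sz_i : size (take i w) = i by rewrite size_takel //; lia.
exists C', (\sum_(k <- ks | (k <= Posz i)%R) size (C k) +
  (\sum_(1 <= k < m.+1) size (B k) +
   \sum_(k <- ks | (Posz j < k)%R) size (C k))).
split.
- split=> [k|].
    have [k_i|i_k] := ltP k (Posz i).
      rewrite !C'1; [|lia..]; have := cells k; congr cell_ok.
      case: k k_i => //= k k_i.
      by rewrite nth_cat sz_i ifT ?nth_take //; lia.
    have kE : k = Posz (i + `|k - Posz i|%N) by lia.
    move: (`|k - Posz i|%N) kE => n -> {k i_k}.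
    rewrite locate_left; last lia.
    have [n_m|m_n] := ltnP n m.
      have -> : (Posz (i + n) + 1)%R = Posz (i + n.+1) by lia.
      rewrite !C'2 //; last exact: ltnW.
      have := v_ok n n_m; congr cell_ok => /=.
      by rewrite nth_cat sz_i ifN ?addKn ?nth_cat ?n_m //; lia.
    rewrite !C'3; [|lia..].
    have := cells (Posz (n - m + j)); rewrite locate_left; last lia.
    congr cell_ok; [|congr C; lia..] => /=.
    rewrite !nth_cat sz_i ifN; last lia.
    by rewrite ifN ?nth_drop; [congr nth; lia|lia].
  (* A finite support: the old one up to [i], all new boundaries, and the old one beyond [j],
     shifted. *)
  exists ([seq k <- ks | (k <= Posz i)%R] ++
    (map Posz (index_iota i.+1 (i + m).+1) ++
    [seq (k - Posz j + Posz (i + m))%R | k <- ks & (Posz j < k)%R])).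
    rewrite !cat_uniq filter_uniq //= uniq_Posz_iota map_inj_uniq; last first.
      by move=> x y; lia.
    rewrite filter_uniq // andbT /=; apply/andP; split; apply/hasPn => x.
      rewrite mem_cat => /orP[] /mapP[k].
        rewrite mem_index_iota => k_in -> /=; rewrite mem_filter; lia.
      by rewrite mem_filter => /andP[? _] ->; rewrite /= mem_filter; lia.
    case/mapP => k; rewrite mem_filter => /andP[? _] -> /=.
    by apply/mapP => -[k']; rewrite mem_index_iota; lia.
  split=> [k|].
    rewrite !mem_cat !negb_or mem_filter => /and3P[k1 k2 k3].
    have [k_i|i_k] := leP k (Posz i).
      by rewrite C'1 // supp //; move: k1; rewrite k_i.
    have [k_im|im_k] := leP k (Posz (i + m)).
      case/mapP: k2; exists `|k|%N; last lia.
      by rewrite mem_index_iota; lia.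
    rewrite C'3 ?supp //; last exact: ltW.
    apply: contra k3 => k3; apply/mapP.
    exists (k - Posz (i + m) + Posz j)%R.
      by rewrite mem_filter k3 andbT; lia.
    by lia.
  rewrite !big_cat big_filter !big_map big_filter /=; congr (_ + (_ + _)).
  + by apply: eq_bigr => k k_i; rewrite C'1.
  + have -> : (i + m).+1 = m.+1 + i by lia.
    rewrite -[i.+1]add1n big_addn addnK.
    rewrite !big_nat; apply: eq_bigr => k k_in; rewrite addnC C'2 //; lia.
  + by apply: eq_bigr => k k_j; rewrite C'3 ?addrK ?subrK //; lia.
- rewrite -tE [\sum_(k <- ks) _](bigID (fun k => (k <= Posz i)%R)) /=.
  have -> : \sum_(i.+1 <= k < j.+1) size (C (Posz k)) =
      \sum_(k <- ks | (Posz i < k <= Posz j)%R) size (C k).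
    rewrite -(big_map Posz xpredT (fun k => size (C k))).
    rewrite (sum_support ks_uniq supp) ?uniq_Posz_iota //.
    apply: eq_bigl => k; apply/mapP/idP => [[k']|k_in].
      by rewrite mem_index_iota; lia.
    by exists `|k|%N; [rewrite mem_index_iota|]; lia.
  rewrite [\sum_(k <- ks | ~~ _) _](bigID (fun k => (k <= Posz j)%R)) /=.
  rewrite [X in _ = _ + (X + _) + _](eq_bigl
    (fun k => (Posz i < k <= Posz j)%R)); last by move=> k; lia.
  rewrite [X in _ = _ + (_ + X) + _](eq_bigl (fun k => (Posz j < k)%R)).
    by rewrite /=; lia.
  by move=> k; lia.
- by move=> k k_i; rewrite C'1 //; lia.
- by move=> k j_k; rewrite C'3; [congr C; lia|lia].
Qed.

(** * Computations on a part as compatible families *)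

Definition internal (x : pconfig M) (z : seq (pconfig M)) k :=
  flatten (pairmap (pcross k) x z).

(** Because of the absolute value, only nonnegative positions are meaningful. *)
Definition part_tape w (k : int) := nth (blank M) w `|k|%N.

Lemma write_part_tape w (i : nat) b (k : int) :
  (0 <= k)%R -> write (Posz i) b (part_tape w) k =
  part_tape (set_nth (blank M) w i b) k.
Proof.
rewrite /write /part_tape nth_set_nth /= => k_ge0.
by have -> : (`|k|%N == i) = (k == Posz i) by lia.
Qed.

Lemma set_nth_rcons w a b :
  set_nth (blank M) (rcons w a) (size w) b = rcons w b.
Proof. by elim: w => //= x w ->. Qed.

Lemma pstep_reenter_left w p c1 c2 r p' b :
  0 < size w -> (r, b, false) \in delta p (part_tape w 0%R) ->
  pstep (PConf (r :: p' :: c1) w 0 p c2)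
    (PConf c1 (set_nth (blank M) w 0 b) 0 p' c2).
Proof. by case: w => // a w _; apply: PLeft. Qed.

Lemma pstep_end_left w p r b :
  0 < size w -> (r, b, false) \in delta p (part_tape w 0%R) ->
  pstep (PConf [:: r] w 0 p [::]) (PEnd M).
Proof. by case: w => // a w _; apply: PEndLeft. Qed.

Lemma pstep_reenter_right w i p c1 c2 r p' b :
  size w = i.+1 -> (r, b, true) \in delta p (part_tape w i) ->
  pstep (PConf c1 w i p (r :: p' :: c2))
    (PConf c1 (set_nth (blank M) w i b) i p' c2).
Proof.
case/lastP: w => // w a; rewrite size_rcons => -[<-].
rewrite /part_tape /= nth_rcons ltnn eqxx set_nth_rcons; exact: PRight.
Qed.

Lemma pstep_end_right w i p r b :
  size w = i.+1 -> (r, b, true) \in delta p (part_tape w i) ->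
  pstep (PConf [::] w i p [:: r]) (PEnd M).
Proof.
case/lastP: w => // w a; rewrite size_rcons => -[<-].
rewrite /part_tape /= nth_rcons ltnn eqxx; exact: PEndRight.
Qed.

(* [c1] and [c2] at the two ends of a part of size [n], [f] inside. *)
Definition bounds c1 c2 (n : nat) (f : nat -> seq (state M)) (k : int) :=
  if k == 0%R then c1 else if k == Posz n then c2 else f `|k|%N.

Lemma bounds_push_internal c1 c2 n f (e : nat) p (k : int) :
  0 < e -> e < n -> (0 <= k)%R ->
  bounds c1 c2 n (fun j => (if j == e then [:: p] else [::]) ++ f j) k =
  push (Posz e) p (bounds c1 c2 n f) k.
Proof.
rewrite /bounds /push => e_gt0 e_n k_ge0.
have -> : (`|k|%N == e) = (k == Posz e) by lia.
have [->|_] := eqVneq k (Posz e); last by [].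
by rewrite !ifN //; lia.
Qed.

Lemma bounds_push_left c1 c2 n f p :
  bounds (p :: c1) c2 n f = push 0%R p (bounds c1 c2 n f).
Proof. by apply/funext => k; rewrite /bounds /push; case: eqP. Qed.

Lemma bounds_push_right c1 c2 n f p :
  0 < n -> bounds c1 (p :: c2) n f = push (Posz n) p (bounds c1 c2 n f).
Proof.
move=> n_gt0; apply/funext => k; rewrite /bounds /push.
by have [->|] := eqVneq k 0%R; [rewrite ifN //; lia|case: ifP].
Qed.

Lemma bounds_nil n : bounds [::] [::] n (fun=> [::]) = fun=> [::].
Proof. by apply/funext => k; rewrite /bounds !if_same. Qed.

Lemma internal_moveR c1 w i p c2 c1' w' p' c2' ys :
  internal (PConf c1 w i p c2) (PConf c1' w' i.+1 p' c2' :: ys) =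
  fun j => (if j == i.+1 then [:: p'] else [::]) ++
    internal (PConf c1' w' i.+1 p' c2') ys j.
Proof.
apply/funext => j; rewrite /internal /=; congr (_ ++ _).
by congr (if _ then _ else _); lia.
Qed.

Lemma internal_moveL c1 w i p c2 c1' w' p' c2' ys :
  internal (PConf c1 w i.+1 p c2) (PConf c1' w' i p' c2' :: ys) =
  fun j => (if j == i.+1 then [:: p'] else [::]) ++
    internal (PConf c1' w' i p' c2') ys j.
Proof.
apply/funext => j; rewrite /internal /=; congr (_ ++ _).
by congr (if _ then _ else _); lia.
Qed.

Lemma internal_reenter c1 w i p c2 c1' w' p' c2' ys :
  internal (PConf c1 w i p c2) (PConf c1' w' i p' c2' :: ys) =
  internal (PConf c1' w' i p' c2') ys.
Proof. by apply/funext => j; rewrite /internal /= ifN //; lia. Qed.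

Lemma internal_end c1 w i p c2 :
  internal (PConf c1 w i p c2) [:: PEnd M] = fun=> [::].
Proof. by []. Qed.

(** The path is undone step by step. A re-entry is two moves: one out of the part by a transition of
    [M], and a fictitious one back from cell -1 or cell [size w]. An ending is a single move out. *)
Lemma part_path_cells c1 w i p c2 ys :
  path (fun x y => `[< pstep x y >]) (PConf c1 w i p c2) ys ->
  last (PConf c1 w i p c2) ys = PEnd M -> i < size w ->
  forall k, (0 <= k)%R -> (k < Posz (size w))%R ->
  let C := bounds c1 c2 (size w) (internal (PConf c1 w i p c2) ys) in
  cell_ok (locate i p k) (part_tape w k) (C k) (C (k + 1)%R).
Proof.
elim: ys c1 w i p c2 => [//|y ys IH] c1 w i p c2 /=.
case/andP=> /asboolP xy yz zE i_w k k_ge0 k_w.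
have end_nil : y = PEnd M -> ys = [::].
  case: ys yz {IH zE} => //= x ys /andP[/asboolP yx _] yE.
  by subst; inversion yx.
inversion xy as [c1' w' i' p0 c2' p' b lt_i del|c1' w' i' p0 c2' p' b lt_i del
 |c1' w' p0 c2' r p' a b del|c1' w' p0 c2' r p' a b del
 |w' p0 r a b del|w' p0 r a b del]; subst.
- have sz : size (set_nth (blank M) w i b) = size w.
    by rewrite size_set_nth; lia.
  rewrite internal_moveR !bounds_push_internal //; last lia.
  have exitE : Posz i.+1 = exit (Posz i) true by rewrite /exit; lia.
  rewrite exitE; apply: (cell_unmove (h := Posz i) (tape := part_tape w) del).
  rewrite write_part_tape //= -PoszD addn1 -sz.
  by apply: IH yz zE _ _ _ _; rewrite ?sz //; lia.
- have sz : size (set_nth (blank M) w i'.+1 b) = size w.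
    by rewrite size_set_nth; lia.
  rewrite internal_moveL !bounds_push_internal //; [|lia..].
  apply: (cell_unmove (h := Posz i'.+1) (d := false)
    (tape := part_tape w) del).
  rewrite write_part_tape //= -sz.
  have -> : (Posz i'.+1 + -1)%R = Posz i' by lia.
  by apply: IH yz zE _ _ _ _; rewrite ?sz //; lia.
- rewrite internal_reenter !bounds_push_left.
  apply: (cell_unmove (h := 0%R) (b := b) (d := false)) => //.
  rewrite write_part_tape //.
  apply: (@cell_unmove_other (-1)%R r p' _ true); first lia.
  exact: IH yz zE isT k k_ge0 k_w.
- rewrite internal_reenter !bounds_push_right ?size_rcons //.
  have exitE : Posz (size w').+1 = exit (Posz (size w')) true.
    by rewrite /exit; lia.
  rewrite {1 3}exitE.
  apply: (cell_unmove (b := b) (d := true)).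
    by rewrite /part_tape /= nth_rcons ltnn eqxx.
  rewrite write_part_tape // set_nth_rcons.
  have -> : (Posz (size w') + shift true)%R = Posz (size w').+1.
    by rewrite /=; lia.
  apply: (@cell_unmove_other (Posz (size w').+1) r p' _ false).
    by move: k_w; rewrite size_rcons; lia.
  have -> : (Posz (size w').+1 + shift false)%R = Posz (size w').
    by rewrite /=; lia.
  have := IH _ _ _ _ _ yz zE; rewrite !size_rcons in k_w *.
  by apply.
- rewrite (end_nil erefl) internal_end bounds_push_left bounds_nil.
  apply: (cell_unmove (h := 0%R) (b := b) (d := false)) => //.
  exact: CellStop.
- rewrite (end_nil erefl) internal_end bounds_push_right ?size_rcons //.
  rewrite bounds_nil.
  have -> : Posz (size w').+1 = exit (Posz (size w')) true.
    by rewrite /exit; lia.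
  apply: (cell_unmove (b := b) (d := true)); last exact: CellStop.
  by rewrite /part_tape /= nth_rcons ltnn eqxx.
Qed.

(** The start configuration has already used the first state on the left; a fictitious move from
    cell -1 to cell 0 restores it, so both ends carry [q :: s]. The length counts the right end but
    not the left one. *)
Lemma part_computation_cells w q s zs :
  0 < size w -> part_computation w (q :: s) zs ->
  exists B, [/\ part_ok w B, B 0 = q :: s, B (size w) = q :: s &
    part_length w (q :: s) zs = \sum_(1 <= k < (size w).+1) size (B k)].
Proof.
move=> w_gt0 [ys [-> pth lst]].
pose f := internal (PConf s w 0 q (q :: s)) ys.
exists (fun k => bounds (q :: s) (q :: s) (size w) f (Posz k)); split=> //.
- move=> k k_w; have := part_path_cells pth lst w_gt0 (k := Posz k) isT k_w.
  move=> /(@cell_unmove_other (-1)%R q q _ true _ (Posz k) isT).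
  rewrite locate_left; last lia.
  have -> : exit (-1)%R true = 0%R by [].
  rewrite -bounds_push_left.
  by have -> : (Posz k + 1)%R = Posz k.+1 by lia.
- by rewrite /bounds eqxx ifN //; lia.
- rewrite /part_length big_nat_recr //=; congr (_ + _).
    rewrite !big_nat; apply: eq_bigr => k /andP[k_gt0 k_w].
    rewrite /bounds /part_crossing_seq /= !ifN //; lia.
  by rewrite /bounds eqxx ifN //; lia.
Qed.

Lemma popK e C p S : C e = p :: S -> push e p (pop e C) = C.
Proof.
move=> CS; apply/funext => k; rewrite /push /pop.
by case: eqP => // ->; rewrite CS.
Qed.

Lemma pop_nil e C k : C k = [::] -> pop e C k = [::].
Proof. by rewrite /pop => ->; case: ifP. Qed.

Lemma pop_other e C k : k != e -> pop e C k = C k.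
Proof. by rewrite /pop => /negPf ->. Qed.

Lemma pop_same e C p S : C e = p :: S -> pop e C e = S.
Proof. by rewrite /pop eqxx => ->. Qed.

(* While the head is inside the part, an odd number of crossings of its two
   ends remains, so the head cannot stop there.  Leaving and re-entering on the
   left is a move to the fictitious cell -1 and back. *)
Lemma cells_part_path t w i p C :
  i < size w -> (forall k, ((k < 0) || (Posz (size w) < k))%R -> C k = [::]) ->
  odd (size (C 0%R) + size (C (Posz (size w)))) ->
  (forall k, (0 <= k < Posz (size w))%R ->
    cell_ok (locate i p k) (part_tape w k) (C k) (C (k + 1)%R)) ->
  total C t ->
  exists ys, let x := PConf (C 0%R) w i p (C (Posz (size w))) in
    [/\ path (fun x y => `[< pstep x y >]) x ys, last x ys = PEnd M &
    forall k : nat, 0 < k < size w -> internal x ys k = C k].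
Proof.
elim/ltn_ind: t w i p C => t IH w i p C i_w supp parity ok tot.
have convex (lo hi x y z : int) : (lo <= x <= hi)%R -> (lo <= z <= hi)%R ->
    (x <= y)%R -> (y <= z)%R -> (lo <= y <= hi)%R by lia.
have [nilC|[p' [b [d [S [del CS moved]]]]]] := @cells_move
    (fun k => (0 <= k <= Posz (size w).-1)%R) (Posz i) p (part_tape w) C
    (convex _ _) ltac:(lia) (fun k k_in => ok k ltac:(lia)).
  move: parity; have [->] := nilC 0%R ltac:(lia).
  have [|_] := nilC (Posz (size w).-1); first by lia.
  by have -> : (Posz (size w).-1 + 1)%R = Posz (size w) by [lia]; move->.
have [t' tE tot'] := total_pop CS tot; have t'_t : t' < t by lia.
set v := set_nth (blank M) w i b.
have sz : size v = size w by rewrite size_set_nth; lia.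
have {}moved k : (0 <= k < Posz (size w))%R ->
    cell_ok (locate (Posz i + shift d)%R p' k) (part_tape v k)
      (pop (exit i d) C k) (pop (exit i d) C (k + 1)%R).
  move=> k_in; have := moved k ltac:(lia); rewrite write_part_tape //; lia.
have supp' k : ((k < 0) || (Posz (size w) < k))%R ->
    pop (exit i d) C k = [::] by move/supp; apply: pop_nil.
have [e0|e0] := eqVneq (exit i d) 0%R.
  have [i0 d0] : i = 0 /\ d = false by move: e0; rewrite /exit; case: (d); lia.
  subst i d; rewrite /= in CS del tot' moved supp' *.
  (* If this was the last crossing of the left end, the head stands on cell -1 with nothing left to
     do. Then [cells_nil], with that cell included, empties all other boundaries, as the ending
     configuration requires. *)
  case: S CS => [|p'' S] CS.
    have nilC k : (-1 <= k <= Posz (size w).-1)%R -> pop 0%R C (k + 1)%R = [::].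
      move=> k_in; have := @cells_nil
        (fun k => (-1 <= k <= Posz (size w).-1)%R) (-1)%R p' (part_tape v)
        (pop 0%R C) (convex _ _) ltac:(lia).
      case/(_ _ _ _ k k_in) => //.
      - move=> l l_in; have [->|l_ne] := eqVneq l (-1)%R.
          rewrite supp' // (pop_same CS); exact: CellStop.
        by apply: moved; lia.
      - by apply: supp'.
      - exact: pop_same CS.
    have Cnil k : 0 < k -> k <= size w -> C (Posz k) = [::].
      move=> k_gt0 k_w; have := nilC (Posz k.-1) ltac:(lia).
      have -> : (Posz k.-1 + 1)%R = Posz k by lia.
      by rewrite pop_other //; lia.
    exists [:: PEnd M]; rewrite CS (Cnil (size w)) //=; split=> //.
      rewrite andbT; apply/asboolP; exact: pstep_end_left del.
    by move=> k /andP[k_gt0 k_w]; rewrite Cnil // ltnW.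
  have CS' := pop_same CS.
  have [t'' t'E tot''] := total_pop CS' tot'.
  have := IH t'' ltac:(lia) v 0 p'' (pop 0%R (pop 0%R C)).
  have Cn : pop 0%R (pop 0%R C) (Posz (size w)) = C (Posz (size w)).
    by rewrite !pop_other //; lia.
  rewrite sz Cn (pop_same CS'); case=> //.
  - by move=> k /supp'; apply: pop_nil.
  - by move: parity; rewrite CS /= negbK.
  - move=> k k_in; apply: (@cell_move_other (-1)%R p' p'' _ true _ k S).
    + by lia.
    + by [].
    + exact: moved.
  move=> ys [pth lst int_ys].
  exists (PConf S v 0 p'' (C (Posz (size w))) :: ys); rewrite CS; split=> //=.
    by rewrite pth andbT; apply/asboolP; exact: pstep_reenter_left del.
  move=> k k_in; rewrite internal_reenter int_ys // !pop_other //; lia.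
have [en|en] := eqVneq (exit i d) (Posz (size w)).
  have d1 : d = true by move: en; rewrite /exit; case: (d) => //; lia.
  subst d; rewrite en in CS tot' moved supp' *.
  have wE : size w = i.+1 by move: en; rewrite /exit; lia.
  have headE : (Posz i + shift true)%R = Posz (size w) by rewrite /= wE; lia.
  rewrite headE in moved.
  case: S CS => [|p'' S] CS.
    have nilC k : (0 <= k <= Posz (size w))%R -> pop (Posz (size w)) C k = [::].
      move=> k_in; have := @cells_nil
        (fun k => (0 <= k <= Posz (size w))%R) (Posz (size w)) p' (part_tape v)
        (pop (Posz (size w)) C) (convex _ _) ltac:(lia).
      case/(_ _ _ _ k k_in) => //.
      - move=> l l_in; have [->|l_ne] := eqVneq l (Posz (size w)).
          rewrite (pop_same CS) supp'; first exact: CellStop.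
          by lia.
        by apply: moved; lia.
      - exact: pop_same CS.
      - by apply: supp'; lia.
    have Cnil k : k < size w -> C (Posz k) = [::].
      move=> k_w; have := nilC (Posz k) ltac:(lia).
      by rewrite pop_other //; lia.
    exists [:: PEnd M]; rewrite CS (Cnil 0) ?wE //=; split=> //.
      rewrite andbT; apply/asboolP; exact: pstep_end_right del.
    by move=> k /andP[_ k_w]; rewrite Cnil // wE.
  have CS' := pop_same CS.
  have [t'' t'E tot''] := total_pop CS' tot'.
  have := IH t'' ltac:(lia) v i p''
    (pop (Posz (size w)) (pop (Posz (size w)) C)).
  have C0 : pop (Posz (size w)) (pop (Posz (size w)) C) 0%R = C 0%R.
    by rewrite !pop_other //; lia.
  rewrite sz C0 (pop_same CS'); case=> //.
  - by move=> k /supp'; apply: pop_nil.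
  - by move: parity; rewrite CS !addnS /= negbK.
  - move=> k k_in.
    have -> : Posz i = (Posz (size w) + shift false)%R by rewrite /= wE; lia.
    apply: (@cell_move_other _ p' p'' _ false _ k S).
    + by lia.
    + by [].
    + exact: moved.
  move=> ys [pth lst int_ys].
  exists (PConf (C 0%R) v i p'' S :: ys); rewrite CS; split=> //=.
    by rewrite pth andbT; apply/asboolP; exact: pstep_reenter_right del.
  move=> k k_in; rewrite internal_reenter int_ys // !pop_other //; lia.
(* The move stays inside the part: both ends keep their sequences and one internal boundary is
   crossed. *)
have [i' i'E i'_w] :
    exists2 i' : nat, (Posz i + shift d)%R = Posz i' & i' < size w.
  exists `|(Posz i + shift d)%R|%N; move: e0 en; rewrite /exit;
    by case: (d) => /=; lia.
rewrite i'E in moved.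
have := IH t' t'_t v i' p' (pop (exit i d) C).
rewrite sz !(pop_other (e := exit i d)) 1?eq_sym //.
case=> // ys [pth lst int_ys].
exists (PConf (C 0%R) v i' p' (C (Posz (size w))) :: ys); split=> //=.
  rewrite pth andbT; apply/asboolP; move: del i'E e0 en.
  rewrite /exit; case: (d) => /= del i'E e0 en.
    have -> : i' = i.+1 by lia.
    by apply: PMoveR del; lia.
  move: (i) i'E i_w del @v {sz moved int_ys pth lst} => [|j]; first by lia.
  move=> jE j_w del v; have -> : i' = j by lia.
  by apply: PMoveL del; lia.
move=> k k_in; rewrite -[in RHS](popK CS) /push -int_ys // {int_ys pth lst}.
move: i'E; rewrite /exit; case: (d) => /= i'E.
  have -> : i' = i.+1 by lia.
  rewrite internal_moveR.
  have -> : (k == i.+1) = (Posz k == Posz i + 1)%R by lia.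
  by case: ifP.
have -> : i = i'.+1 by lia.
rewrite internal_moveL; have -> : (k == i'.+1) = (Posz k == Posz i'.+1) by lia.
by case: ifP.
Qed.

(** Once the first entry is removed, the ends carry [s] and [q :: s], of odd total length, as
    [cells_part_path] demands. *)
Lemma cells_part_computation w B q s :
  0 < size w -> part_ok w B -> B 0 = q :: s -> B (size w) = q :: s ->
  exists2 zs, part_computation w (q :: s) zs &
    part_length w (q :: s) zs = \sum_(1 <= k < (size w).+1) size (B k).
Proof.
move=> w_gt0 ok B0 Bn.
pose C k := if (0 <= k <= Posz (size w))%R then B `|k|%N else [::].
have C0 : C 0%R = q :: s by rewrite -B0.
have CE k : k <= size w -> C (Posz k) = B k 
  by move=> k_w; rewrite /C (_ : (0 <= Posz k <= Posz (size w))%R) //; lia.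
have tot : total C (\sum_(0 <= k < (size w).+1) size (B k)).
  exists (map Posz (index_iota 0 (size w).+1)); first exact: uniq_Posz_iota.
  split=> [k k_out|]; last first.
    rewrite big_map !big_nat; apply: eq_bigr => k k_in; rewrite CE //; lia.
  rewrite /C ifN //; apply: contra k_out => k_in; apply/mapP.
  by exists `|k|%N; [rewrite mem_index_iota|]; lia.
have [t' _ tot'] := total_pop C0 tot.
have Cn : pop 0%R C (Posz (size w)) = q :: s by rewrite pop_other ?CE //; lia.
have := cells_part_path (w := w) (i := 0) (p := q) w_gt0 _ _ _ tot'.
rewrite Cn (pop_same C0); case.
- by move=> k k_out; apply: pop_nil; rewrite /C ifN //; lia.
- by rewrite /= addnS /= oddD addbb.
- move=> k k_in; apply: (@cell_move_other (-1)%R q q _ true _ k s) => //.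
    by lia.
  rewrite locate_left; last lia.
  have kE : k = Posz `|k|%N by lia.
  have := ok `|k|%N ltac:(lia); rewrite -!CE; [|lia..].
  by rewrite kE /=; have -> : (Posz `|k|%N + 1)%R = Posz `|k|.+1%N by lia.
move=> ys [pth lst int_ys].
exists (PConf s w 0 q (q :: s) :: ys); first by exists ys.
rewrite /part_length big_nat_recr //= Bn; congr (_ + _).
rewrite !big_nat; apply: eq_bigr => k k_in.
rewrite /part_crossing_seq /=.
rewrite -[flatten _]/(internal (PConf s w 0 q (q :: s)) ys k).
by rewrite int_ys // pop_other ?CE //; lia.
Qed.

(** The value -1 makes both sides vacuous, and the value [+oo] arises only from unbounded lengths,
    which violate both sides. *)
Lemma t_maxP w (c : xseq (state M)) n :
  ((0 <= t_max w c)%E -> (t_max w c <= (Posz n)%:E)%E) <->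
  (forall m, part_lengths w c m -> m <= n).
Proof.
rewrite /t_max; case: asboolP => [->|/eqP/set0P[m0 m0P]]; first by split.
case: xgetP => [_ -> [m [mP m_max] <-]|no_max].
  rewrite !lee_fin; split=> [/(_ isT) m_n k /m_max k_m|]; last by move/(_ m mP).
  exact: leq_trans k_m m_n.
split=> [/(_ isT)//|le_n]; exfalso.
have ex_len : exists m, `[< part_lengths w c m >] by exists m0; apply/asboolP.
have [|m /asboolP mP m_max] := @ex_maxnP _ n ex_len.
  by move=> m /asboolP/le_n.
apply: (no_max (Posz m)%:E%E); exists m => //; split=> // k kP.
by apply/m_max/asboolP.
Qed.

(** * Inserting copies of a part and cutting between equal sequences *)

Lemma is_input_cat w1 w2 : is_input (w1 ++ w2) = is_input w1 && is_input w2.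
Proof. exact: all_cat. Qed.

Lemma is_input_take n w : is_input w -> is_input (take n w).
Proof. by move=> /allP w_in; apply/allP => a /mem_take/w_in. Qed.

Lemma is_input_drop n w : is_input w -> is_input (drop n w).
Proof. by move=> /allP w_in; apply/allP => a /mem_drop/w_in. Qed.

(** Each copy replaces the empty segment at boundary [i], whose sequence survives, so the next copy
    fits there again. *)
Lemma history_insert w C t i v B :
  is_input w -> history w C t -> 1 <= i <= size w ->
  is_input v -> part_ok v B -> B 0 = C i -> B (size v) = C i ->
  forall n, exists w' C', [/\ is_input w', size w' = size w + n * size v,
    history w' C' (t + n * \sum_(1 <= k < (size v).+1) size (B k)) &
    C' (Posz i) = C i].
Proof.
move=> w_in hist /andP[i_gt0 i_w] v_in v_ok B0 Bn.
elim=> [|n [w' [C' [w'_in w'_sz hist' C'i]]]].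
  by exists w, C; rewrite !addn0.
have i_w' : i <= size w' by lia.
rewrite -C'i in B0 Bn.
have [C2 [t2 [hist2 t2E C2le _]]] :=
  history_replace hist' i_gt0 (leqnn i) i_w' v_ok B0 Bn.
exists (take i w' ++ v ++ drop i w'), C2; split.
- by rewrite !is_input_cat v_in is_input_take ?is_input_drop.
- by rewrite !size_cat size_takel // size_drop; lia.
- suff <- : t2 = t + n.+1 * \sum_(1 <= k < (size v).+1) size (B k) by [].
  by move: t2E; rewrite big_geq // mulSn; lia.
- by rewrite C2le.
Qed.

Lemma history_cut w C t i j :
  is_input w -> history w C t -> 1 <= i -> i < j -> j <= size w ->
  C (Posz i) = C (Posz j) ->
  exists w' C' t', [/\ is_input w', size w' = size w - (j - i),
    history w' C' t',
    t' + \sum_(i.+1 <= k < j.+1) size (C (Posz k)) = t &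
    (forall k : nat, k <= i -> C' k = C k) /\
    (forall k : nat, j <= k -> C' (Posz (k - (j - i))) = C k)].
Proof.
move=> w_in hist i_gt0 ij j_w Cij.
have [//|C' [t' [hist' t'E C'le C'ge]]] :=
  history_replace (v := [::]) (B := fun=> C (Posz i)) hist i_gt0 (ltnW ij) j_w
    _ erefl Cij.
exists (take i w ++ drop j w), C', t'; split=> //.
- by rewrite is_input_cat is_input_take ?is_input_drop.
- by rewrite size_cat size_takel ?size_drop; lia.
- by rewrite t'E big_geq ?addn0.
- split=> // k j_k; rewrite -C'ge //; congr C'; rewrite /=; lia.
Qed.

Lemma card_state_ge3 : 3 <= #|state M|.
Proof.
have /card_uniqP/= <- := states_uniq M; exact: max_card.
Qed.

(* Cutting on both sides of boundary [i] keeps its crossing sequence.  When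
   no cut is possible, each sequence occurs at most twice, and the pigeonhole
   bound on the time forces the input to be short. *)
Lemma short_witness n c D :
  (forall w C t, is_input w -> size w < n -> history w C t ->
    t <= c * size w + D) ->
  forall w C t i, is_input w -> size w <= n -> history w C t ->
    t <= c * size w + D + 1 -> 1 <= i <= size w ->
  exists w' C' t' i', [/\ is_input w', size w' <= D + 8 * #|state M| ^ c,
    history w' C' t', 1 <= i' <= size w' & C' (Posz i') = C (Posz i)].
Proof.
move=> bound w; have [m] := ubnP (size w); elim: m w => // m IHm w w_m.
move=> C t i w_in w_n hist t_le /andP[i_gt0 i_w].
set N := #|state M| ^ c; have [w_le|w_gt] := leqP (size w) (D + 8 * N).
  by exists w, C, t, i; split=> //; rewrite i_gt0.
(* The windows [1..i] and [i.+1..size w] are searched separately so that the cut leaves boundary [i]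
   in place. Without a repetition both estimates add up to $|w|\le D+1+\frac92N$, against [w_gt]. *)
have [i1 [i2 [i1_gt0 i12 i2_w C12 i_out]]] : exists i1 i2 : nat,
    [/\ 1 <= i1, i1 < i2, i2 <= size w, C i1 = C i2 & (i2 <= i) || (i <= i1)].
  have pigeon := pigeonhole card_state_ge3 (fun k => C (Posz k)) c.
  have [[i1 [i2 [? ? ? ?]]]|le1] := pigeon 1 i.
    by exists i1, i2; split=> //; lia.
  have [[i1 [i2 [? ? ? ?]]]|le2] := pigeon i.+1 (size w - i).
    by exists i1, i2; split=> //; lia.
  exfalso; have := sum_le_total 1 (size w).+1 (proj2 hist).
  rewrite (big_cat_nat (n := i.+1)) //=.
  move: le1 le2; rewrite add1n addSn subnKC // (mulSn c i).
  rewrite (mulSn c (size w - i)).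
  have N_gt0 : 0 < N by rewrite expn_gt0 (ltn_trans _ card_state_ge3).
  rewrite mulnBr -/N; have : c * i <= c * size w by rewrite leq_mul2l i_w orbT.
  lia.
have [w' [C' [t' [w'_in w'_sz hist' _ [C'le C'ge]]]]] :=
  history_cut w_in hist i1_gt0 i12 i2_w C12.
(* The cut input is shorter than [n], so the time hypothesis is available again for the
   induction. *)
have t'_le := bound w' C' t' w'_in ltac:(lia) hist'.
have [i_i1|i1_i] := leqP i i1.
  rewrite -C'le //; apply: (IHm w' _ C' t') => //; lia.
rewrite -C'ge; last lia.
apply: (IHm w' _ C' t') => //; lia.
Qed.

End Histories.

Theorem theorem1 (M : ntm) (C D : nat) :
  let q := #|state M| in
  let l := D + 8 * q ^ C in
  let r := D + 12 * q ^ C in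
  let S := \bigcup_(n in [set n | 1 <= n <= l]) crossing_seqs M n in
  runs_in_time M (fun n => C * n + D) <->
  ((forall w : seq (symbol M), is_input w -> size w <= l ->
      forall z, computation w z ->
        le_oo (nsteps z) (Some (C * size w + D))) /\
   (forall c, S c -> forall w : seq (symbol M),
      is_input w -> 1 <= size w <= r ->
      (0 <= t_max w c)%E -> (t_max w c <= (Posz (C * size w))%:E)%E)).
Proof.
move=> q l r S; split=> [fast|[short_fast parts_fast]].
  have hist_fast (w : seq (symbol M)) F t :
      is_input w -> history w F t -> t <= C * size w + D.
    move=> w_in /history_computation[z [comp t_le _]].
    move: t_le (fast w w_in z comp).
    by case: (nsteps z) => //= m; apply: leq_trans.
  split=> [w w_in _ z|].
    exact: fast.
  move=> c [n _ [w [z [i [t [[w_in <-] i_w comp t_le cE]]]]]] v v_in v_sz.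
  apply/t_maxP => m; case: c cE => [[|q1 s] cE|//]; first by case=> zs.
  case=> zs zsP <-; have v_gt0 : 0 < size v by lia.
  have [B [v_ok B0 Bn ->]] := part_computation_cells v_gt0 zsP.
  (* An infinite [t] would need an infinite computation, which the time bound excludes. *)
  case: t t_le cE => [t|] t_le cE; last first.
    by have := fast w w_in z comp; case: (nsteps z) t_le.
  move/crossingsP in cE; rewrite cE in B0 Bn.
  have hist := computation_history comp t_le.
  rewrite leqNgt; apply/negP => slow; set sumB := \sum_(_ <= _ < _) _ in slow.
  (* Each copy exceeds its allowance by at least one step, so [(C * size w + D).+1] copies use up
     more than the whole allowance of [w]. *)
  have [w' [F [w'_in w'_sz hist' _]]] :=
    history_insert w_in hist i_w v_in v_ok B0 Bn (C * size w + D).+1.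
  have := hist_fast w' F _ w'_in hist'; rewrite -/sumB w'_sz.
  have := leq_mul (leqnn (C * size w + D).+1) slow.
  by rewrite mulnDr mulnCA; lia.
suff hist_fast n (w : seq (symbol M)) F t :
    size w = n -> is_input w -> history w F t -> t <= C * size w + D.
  move=> w w_in z comp.
  case zE : (nsteps z) => [m|] /=.
    apply: (hist_fast _ w (crossings z 0 m)) => //.
    by apply: computation_history => //; rewrite zE /=.
  suff : (C * size w + D).+1 <= C * size w + D by rewrite ltnn.
  apply: (hist_fast _ w (crossings z 0 (C * size w + D).+1)) => //.
  by apply: computation_history => //; rewrite zE.
elim/ltn_ind: n w F t => n IHn w F0 t0 w_n w_in hist0.
have bound (w' : seq (symbol M)) F t :
    is_input w' -> size w' < n -> history w' F t -> t <= C * size w' + D.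
  by move=> w'_in w'_n; apply: IHn w'_n w' F t erefl w'_in.
rewrite leqNgt; apply/negP => slow.
have [z [comp t0_le _]] := history_computation hist0.
(* Truncation to just one step beyond the bound keeps the total length small enough for the
   pigeonhole. *)
have {t0_le} t_le : le_oo (Some (C * size w + D).+1) (nsteps z).
  by move: t0_le; case: (nsteps z) => //= m; apply: leq_trans.
have hist := computation_history comp t_le.
set F := crossings z 0 _ in hist.
have [w_l|w_gt] := leqP (size w) l.
  have := short_fast w w_in w_l z comp; move: t_le.
  by case: (nsteps z) => //= m; lia.
have sum_le : \sum_(1 <= k < (size w).+1) size (F (Posz k)) <=
    C * size w + D + 1.
  by rewrite addn1; exact: sum_le_total hist.2.
have [i [j [i_gt0 ij j_w ij_r Fij]]] :=
  pigeonhole_close (card_state_ge3 M) (leqnn r) w_gt sum_le.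
have [w' [F' [t' [w'_in w'_sz hist' t'E _]]]] :=
  history_cut w_in hist i_gt0 ij j_w Fij.
have := bound w' F' t' w'_in ltac:(lia) hist'; rewrite w'_sz => t'_le.
pose v := take (j - i) (drop i w).
have v_sz : size v = j - i by rewrite size_takel // size_drop; lia.
have v_ok : part_ok v (fun k => F (Posz (i + k))).
  by apply: history_part hist i_gt0 _; lia.
have sumE : \sum_(1 <= k < (size v).+1) size (F (Posz (i + k))) =
    \sum_(i.+1 <= k < j.+1) size (F (Posz k)).
  rewrite -[i.+1]add1n big_addn v_sz -subSn; last lia.
  by apply: eq_bigr => k _; rewrite addnC.
(* The cut input obeys the bound, so the segment accounts for at least $C(j-i)+1$ of the $C|w|+D+1$
   steps. *)
have part_slow :
    C * size v < \sum_(1 <= k < (size v).+1) size (F (Posz (i + k))).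
  have C_mul : C * (j - i) <= C * size w by rewrite leq_mul2l; lia.
  by rewrite sumE v_sz; move: t'_le t'E; rewrite mulnBr; lia.
(* With an empty sequence at [i] the head never enters the part, which then takes no steps. *)
have [s0|] := eqVneq (F (Posz i)) [::].
  suff Fnil k : k <= size v -> F (Posz (i + k)) = [::].
    by move: part_slow; rewrite big_nat big1 // => k k_in; rewrite Fnil //; lia.
  elim: k => [|k IHk] k_v; first by rewrite addn0.
  by have := v_ok k k_v; rewrite IHk ?(ltnW k_v) // => /cell_left_nil.
case Fi : (F (Posz i)) => [//|q1 s] _.
have [|||zs zsP zs_len] := cells_part_computation (q := q1) (s := s) _ v_ok.
- by rewrite v_sz subn_gt0.
- by rewrite addn0.
- by rewrite v_sz subnKC -?Fij // ltnW.
(* The same sequence occurs on an input of length at most [l], hence lies in [S]. *)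
have [|||w2 [F2 [t2 [i2 [w2_in w2_sz hist2 i2_w F2i]]]]] :=
  short_witness (i := i) bound w_in _ hist.
- by rewrite w_n.
- by rewrite addn1.
- by rewrite i_gt0 ltnW // (leq_trans ij).
have [z2 [comp2 t2_le cross2]] := history_computation hist2.
have Sc : S (Fin (q1 :: s)).
  exists (size w2).
    by case/andP: i2_w => i2_gt0 /(leq_trans i2_gt0) /= ->.
  exists w2, z2, i2, (Some t2); split=> //.
  by apply/crossingsP; rewrite cross2 F2i.
have v_in : is_input v by rewrite is_input_take ?is_input_drop.
have v_le : 1 <= size v <= r by rewrite v_sz subn_gt0 ij.
have /t_maxP tmax_le := parts_fast _ Sc v v_in v_le.
have := tmax_le _ (ex_intro2 _ _ zs zsP erefl).
by rewrite zs_len leqNgt part_slow.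
Qed.
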